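(* Let $\vec{c}\in\{-1,1\}^n$ with $c_1=1$, and let $A=(a_{ij})\in M_{n,n}(\mathbb{R})$ satisfy $\varphi_{\vec{c}}(A)=A$. Let $i_1<i_2<\cdots<i_r$ be all the indices $i$ with $c_i=1$ (so $1\le r\le n$) and let $j_1<j_2<\cdots<j_{n-r}$ be all the indices $j$ with $c_j=-1$. Let $D=(d_{lm})\in M_{r,r}(\mathbb{R})$ be given by $d_{lm}=a_{i_l i_m}$ for $1\le l,m\le r$, and let $E=(e_{lm})\in M_{n-r,n-r}(\mathbb{R})$ be given by $e_{lm}=a_{j_l j_m}$ for $1\le l,m\le n-r$. Then $A$ is permutation similar to the block-diagonal matrix $\mathrm{diag}(D,E)$.
   Context: $M_{n,n}(\mathbb{R})$ is the set of real $n\times n$ matrices. For $\vec{c}=(c_1,\ldots,c_n)\in\{-1,1\}^n$ with $c_1=1$, the map $\varphi_{\vec{c}}:M_{n,n}(\mathbb{R})\to M_{n,n}(\mathbb{R})$ is defined by $(\varphi_{\vec{c}}(A))_{ij}=c_i\,a_{ij}\,c_j$. Matrices $A,B\in M_{n,n}(\mathbb{R})$ are permutation similar if $B=P^{-1}AP$ for some permutation matrix $P$. When $r=n$ the block $E$ is the empty ($0\times0$) matrix and $\mathrm{diag}(D,E)=D$. *)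

(* Defs.v *)
From HB Require Import structures.
From mathcomp Require Import all_boot all_order all_algebra.
From mathcomp Require Import reals.

Set Implicit Arguments.
Unset Strict Implicit.
Unset Printing Implicit Defensive.

Import Order.TTheory GRing.Theory Num.Theory.
Local Open Scope ring_scope.

Definition phi (R : realType) (n : nat) (c : 'rV[R]_n) (A : 'M[R]_n) : 'M[R]_n :=
  \matrix_(i, j) (c 0 i * A i j * c 0 j).

Definition permutation_similar (R : realType) (n : nat) (A B : 'M[R]_n) : Prop :=
  exists P : 'M[R]_n, is_perm_mx P /\ B = invmx P *m A *m P.

(* f(0) < f(1) < ... < f(k-1) are all the indices satisfying Q *)
Definition increasing_enumeration (n k : nat) (f : 'I_k -> 'I_n)
    (Q : 'I_n -> Prop) : Prop :=
  (forall l m : 'I_k, (l < m)%N -> (f l < f m)%N) /\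
  (forall x : 'I_n, Q x <-> exists l : 'I_k, f l = x).

(* diag(D, E), transported from size r + (n - r) to size n *)
Definition block_diag (R : realType) (n r : nat) (hr : (r <= n)%N)
    (D : 'M[R]_r) (E : 'M[R]_(n - r)) : 'M[R]_n :=
  castmx (subnKC hr, subnKC hr) (block_mx D 0 0 E).

(* Main.v *)
(* The sign condition reads c_k c_l a_kl = a_kl, so the entries of A that link
   an index of sign 1 to an index of sign -1 vanish.  Listing the indices as
   i_1, ..., i_r, j_1, ..., j_(n-r) is a permutation, and reindexing A along it
   leaves D and E as the only nonzero blocks. *)
Require Import Defs.
From HB Require Import structures.
From mathcomp Require Import all_boot all_order all_algebra.
From mathcomp Require Import perm reals.

Set Implicit Arguments.
Unset Strict Implicit.
Unset Printing Implicit Defensive.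

Import Order.TTheory GRing.Theory Num.Theory.
Local Open Scope ring_scope.

Lemma increasing_enumeration_inj n k (f : 'I_k -> 'I_n) (Q : 'I_n -> Prop) :
  increasing_enumeration f Q -> injective f.
Proof.
move=> [f_mono _] l m eq_f; apply/val_inj => /=.
by case: (ltngtP l m) => // /f_mono; rewrite eq_f ltnn.
Qed.

(** Left multiplication by [perm_mx s] reindexes rows along [s], while reindexing columns along [s]
    takes right multiplication by [perm_mx s^-1]; hence the inverse in the witness. *)
Lemma perm_submatrix_similar (R : realType) (n : nat) (A : 'M[R]_n)
    (s : 'S_n) :
  permutation_similar A (\matrix_(k, l) A (s k) (s l)).
Proof.
exists (perm_mx s^-1%g); split; first exact: perm_mx_is_perm.
have -> : invmx (perm_mx s^-1%g) = perm_mx s :> 'M[R]_n.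
  by rewrite -[RHS](mulKmx (unitmx_perm _ s^-1%g)) -perm_mxM mulVg perm_mx1 mulmx1.
rewrite -row_permE -col_permE.
by apply/matrixP => k l; rewrite !mxE.
Qed.

(** The entry equals its own negative, and [R] has characteristic zero. *)
Lemma phi_fixed_eq0 (R : realType) (n : nat) (c : 'rV[R]_n) (A : 'M[R]_n)
    (k l : 'I_n) :
  phi c A = A -> c 0 k * c 0 l = -1 -> A k l = 0.
Proof.
move=> /matrixP /(_ k l); rewrite mxE mulrAC => + ckl.
rewrite ckl mulN1r => /eqP.
by rewrite eq_sym -addr_eq0 -mulr2n mulrn_eq0 => /eqP.
Qed.

Theorem theorem13 (R : realType) (n : nat) (hn : (0 < n)%N)
  (c : 'rV[R]_n)
  (hc : forall k : 'I_n, c 0 k = -1 \/ c 0 k = 1)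
  (hc1 : c 0 (Ordinal hn) = 1)
  (A : 'M[R]_n) (hA : phi c A = A)
  (r : nat) (i : 'I_r -> 'I_n) (j : 'I_(n - r) -> 'I_n)
  (hi : increasing_enumeration i (fun k => c 0 k = 1))
  (hj : increasing_enumeration j (fun k => c 0 k = -1))
  (D : 'M[R]_r) (hD : D = \matrix_(l, m) A (i l) (i m))
  (E : 'M[R]_(n - r)) (hE : E = \matrix_(l, m) A (j l) (j m)) :
  (1 <= r)%N /\
  exists hr : (r <= n)%N, permutation_similar A (block_diag hr D E).
Proof.
have inj_i := increasing_enumeration_inj hi.
have inj_j := increasing_enumeration_inj hj.
have ci l : c 0 (i l) = 1 by apply/hi.2; exists l.
have cj m : c 0 (j m) = -1 by apply/hj.2; exists m.
have neq_ij l m : i l <> j m.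
  move=> eq_ij; have := ci l; rewrite eq_ij cj => /eqP.
  by rewrite eq_sym -addr_eq0 -mulr2n pnatr_eq0.
(* The first index has sign 1, so [i] attains it and ['I_r] is inhabited. *)
split; first by have [[l lt_lr] _] := (hi.2 _).1 hc1; apply: leq_ltn_trans lt_lr.
have hr : (r <= n)%N by have := leq_card i inj_i; rewrite !card_ord.
exists hr.
pose h (k : 'I_n) := match split (cast_ord (esym (subnKC hr)) k) with
  | inl l => i l | inr m => j m end.
(* An injective self-map of the finite type ['I_n] is a permutation. In the mixed cases a common
   value would have both signs. *)
have inj_h : injective h.
  move=> k1 k2; rewrite /h.
  case: splitP => l1 e1; case: splitP => l2 e2 /=.
  - by move/inj_i => eq_l; apply/val_inj; move: e1 e2 => /= -> ->; rewrite eq_l.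
  - by move/neq_ij.
  - by move/esym/neq_ij.
  - by move/inj_j => eq_l; apply/val_inj; move: e1 e2 => /= -> ->; rewrite eq_l.
suff -> : block_diag hr D E = \matrix_(k, l) A (perm inj_h k) (perm inj_h l).
  exact: perm_submatrix_similar.
apply/matrixP => k l; rewrite castmxE !mxE !permE /h hD hE.
(* [block_mx] and [h] split the same cast indices. The diagonal blocks agree at once; in the other
   two the signs multiply to -1. *)
case: (split _) => k'; rewrite !mxE; case: (split _) => l'; rewrite !mxE //.
- by rewrite (phi_fixed_eq0 hA) // ci cj mul1r.
- by rewrite (phi_fixed_eq0 hA) // ci cj mulr1.
Qed.
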